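(* Let $V$ be a real vector space and let $\mu\in V\otimes\wedge^2V^*$ be a Lie bracket on $V$ such that the Lie algebra $(V,\mu)$ is semi-simple. Then $\mu$ is not in the null cone of any $O(p,q)$-action; that is, for all $p,q\geq 0$ with $p+q=\dim V\ge 3$ and every non-degenerate symmetric bilinear form $g$ of signature $(p,q)$ on $V$, $\mu$ is not in the null cone $\mathcal{N}$ of the action of $O(p,q)=O(V,g)$.
   Context: All Lie algebras are real and finite-dimensional. Given a non-degenerate symmetric bilinear form $g$ of signature $(p,q)$ on a real vector space $V$ of dimension $p+q$, $O(p,q)$ denotes the group of linear isometries of $(V,g)$. It acts on $\mathcal{V}:=V\otimes\wedge^2V^*$ (skew-symmetric bilinear maps $V\times V\to V$) by $(A\cdot\mu)(X,Y)=A^{-1}(\mu(AX,AY))$. The null cone is $$\mathcal{N}=\{\mu\in\mathcal{V}:\ \mu\text{ satisfies the Jacobi identity and } 0\in\overline{O(p,q)\cdot\mu}\},$$ where the closure of the orbit is taken in the usual topology of the finite-dimensional real vector space $\mathcal{V}$. *)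

(* Defs.v *)
From HB Require Import structures.
From mathcomp Require Import all_boot all_order all_algebra.
From mathcomp Require Import boolp classical_sets reals topology normedtype.

Set Implicit Arguments.
Unset Strict Implicit.
Unset Printing Implicit Defensive.

Import GRing.Theory Num.Theory.
Import numFieldNormedType.Exports.

Local Open Scope classical_set_scope.
Local Open Scope ring_scope.

(* Bilinear maps V x V -> V in curried form; [mu X Y] is the bracket of X and
   Y. The curried type is used because it is itself a vectType. *)
Notation bilin V := 'Hom(V, 'End(V)).

Section LieAlgebra.
Variables (R : realType) (V : vectType R).
Implicit Types (mu : bilin V) (U W I : {vspace V}).

Definition skew mu := forall X Y : V, mu X Y = - mu Y X.

Definition jacobi mu := forall X Y Z : V,
  mu X (mu Y Z) + mu Y (mu Z X) + mu Z (mu X Y) = 0.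

Definition lie_bracket mu := skew mu /\ jacobi mu.

(* [U, W]: the span of all brackets mu X Y with X in U and Y in W; summing over
   a basis of U suffices, see bracketv_subP. *)
Definition bracketv mu U W : {vspace V} := (\sum_(X <- vbasis U) mu X @: W)%VS.

Definition derived_series mu U (k : nat) : {vspace V} :=
  iter k (fun W => bracketv mu W W) U.

Definition lie_solvable mu U := exists k, derived_series mu U k = 0%VS.

Definition lie_ideal mu I := forall X Y : V, Y \in I -> mu X Y \in I.

(* The radical, i.e. the largest solvable ideal, vanishes. *)
Definition semisimple mu :=
  forall I, lie_ideal mu I -> lie_solvable mu I -> I = 0%VS.

Lemma bracketv_subP mu U W I :
  reflect (forall X Y, X \in U -> Y \in W -> mu X Y \in I)
          (bracketv mu U W <= I)%VS.
Proof.
apply: (iffP idP) => [sI X Y XU YW|H].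
  rewrite (coord_vbasis XU) linear_sum sum_lfunE /=.
  apply: rpred_sum => i _; rewrite linearZ /= scale_lfunE; apply: rpredZ.
  apply: (subvP sI); rewrite /bracketv big_tnth.
  rewrite (bigD1 (cast_ord (esym (size_tuple _)) i)) //=.
  apply: (subvP (addvSl _ _)); rewrite (tnth_nth 0) /=.
  exact: memv_img.
rewrite /bracketv big_seq; elim/big_ind: _ => [|A B|X /vbasis_mem XU].
- exact: sub0v.
- by move=> AI BI; rewrite subv_add AI.
- by apply/subvP => _ /memv_imgP[Y YW ->]; exact: H.
Qed.

End LieAlgebra.

Section NullCone.
Variables (R : realType) (V : vectType R).
Implicit Types (g : {symmetric V}) (mu nu : bilin V) (A : 'End(V)).

(* Signature (p, q): some basis is orthonormal with p vectors of square 1 and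
   q vectors of square -1. *)
Definition has_signature (p q : nat) g :=
  exists e : (p + q).-tuple V, basis_of fullv e /\
    forall i j : 'I_(p + q), g (tnth e i) (tnth e j) =
      if i == j then (if (i < p)%N then 1 else -1) else 0.

(* O(V, g), the group of linear isometries. *)
Definition isometry_group g : set 'End(V) :=
  [set A | lker A = 0%VS /\ forall X Y, g (A X) (A Y) = g X Y].

(* (A . mu)(X, Y) = A^-1 (mu (A X) (A Y)), see lie_actE; the lfun inverse
   A^-1%VF is the true inverse when lker A = 0. *)
Definition lie_act A mu : bilin V :=
  linfun (fun X : V => (A^-1 \o mu (A X) \o A)%VF).

Lemma lie_actE A mu (X Y : V) : lie_act A mu X Y = (A^-1)%VF (mu (A X) (A Y)).
Proof.
pose f X : 'End(V) := (A^-1 \o mu (A X) \o A)%VF.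
have f_lin : linear f.
  move=> a x y; apply/lfunP => z.
  by rewrite add_lfunE scale_lfunE !comp_lfunE !linearP add_lfunE scale_lfunE linearP.
pose Lf := GRing.isLinear.Build R V 'End(V) _ f f_lin.
pose F : {linear V -> 'End(V)} := HB.pack f Lf.
by rewrite /lie_act -/f (lfunE F) /= /f !comp_lfunE.
Qed.

Lemma skew_lie_act A mu : skew mu -> skew (lie_act A mu).
Proof. by move=> smu X Y; rewrite !lie_actE smu linearN. Qed.

Definition lie_orbit g mu : set (bilin V) :=
  [set nu | exists2 A, isometry_group g A & nu = lie_act A mu].

(* The usual topology of a finite-dimensional real vector space W, transported
   along the coordinate isomorphism given by a basis of W; it does not depend on
   the basis. *)
Definition usual_topology (W : vectType R) :=
  initial_topology (passmx.rVof (vbasis {:W}) : W -> 'rV[R]_(\dim {:W})).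

(* The closure is taken in the space of all bilinear maps; by skew_lie_act the
   orbit lies in the linear subspace of skew maps, which carries the subspace
   topology, so this agrees with the closure in V (x) /\^2 V^*. *)
Definition null_cone g : set (bilin V) :=
  [set mu | [/\ skew mu, jacobi mu &
     closure (lie_orbit g mu : set (usual_topology (bilin V))) (0 : bilin V)]].

End NullCone.

(* Main.v *)
(* If 0 were in the closure of the orbit, the determinant of the Gram matrix of
   the Killing form, which is continuous and invariant under isometries because
   they have determinant 1 or -1, would vanish at mu. So it suffices to prove
   Cartan's criterion: the Killing form of a semisimple algebra is nondegenerate.

   Let I be the radical of the Killing form and x in [I, I]. Over the complex
   numbers, let S act as the conjugate of lambda on each generalized eigenspace
   of ad x of eigenvalue lambda. Conjugation is additive, so S is a derivation;
   writing x as a sum of brackets [y, z] turns tr(ad x S) into a sum of terms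
   K(y, S z), which vanish, whereas tr(ad x S) is the sum of the |lambda|^2.
   Hence ad x is nilpotent, I is solvable by Engel's theorem, and I = 0. *)

Require Import Defs.
From HB Require Import structures.
From mathcomp Require Import all_boot all_order all_algebra.
From mathcomp Require Import boolp classical_sets reals topology normedtype.
From mathcomp Require Import ring complex.

Set Implicit Arguments.
Unset Strict Implicit.
Unset Printing Implicit Defensive.

Import Order.TTheory GRing.Theory Num.Theory.
Import numFieldNormedType.Exports.
Import passmx.

Local Open Scope classical_set_scope.
Local Open Scope ring_scope.

(** * Derivations over the complex numbers *)

(** Chinese remainder theorem for powers of distinct linear factors, one point at a time. With
    complex conjugation as [f] it makes the desired [S] a polynomial in [T]. *)
Lemma poly_interpolation (F : fieldType) (f : F -> F) (N : nat) (s : seq F) :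
  exists p : {poly F}, forall x, x \in s -> ('X - x%:P) ^+ N %| p - (f x)%:P.
Proof.
elim: s => [|x s [p Hp]]; first by exists 0.
have [xs|xNs] := boolP (x \in s).
  by exists p => y; rewrite inE => /predU1P[->|]; apply: Hp.
pose q := \prod_(y <- s) ('X - y%:P) ^+ N.
have /Bezout_eq1_coprimepP[[u v] /= uv1] : coprimep q (('X - x%:P) ^+ N).
  rewrite coprimep_expr // coprimep_sym /q; elim: s xNs {Hp q} => [|y s IH] /=.
    by rewrite big_nil coprimep1.
  rewrite inE negb_or => /andP[xy xNs]; rewrite big_cons coprimepMr IH // andbT.
  by rewrite coprimep_expr // coprimep_XsubC root_XsubC eq_sym.
(* [u * q] is 1 modulo the new factor and 0 modulo the earlier ones. *)
exists (p + u * q * ((f x)%:P - p)) => y; rewrite inE => /predU1P[->|ys].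
  have -> : p + u * q * ((f x)%:P - p) - (f x)%:P =
      v * ('X - x%:P) ^+ N * (p - (f x)%:P).
    have -> : u * q = 1 - v * ('X - x%:P) ^+ N by rewrite -uv1 addrK.
    by ring.
  by rewrite dvdp_mulr ?dvdp_mull.
rewrite addrAC dvdp_add ?Hp // -mulrA dvdp_mull // dvdp_mulr // /q.
by rewrite (big_rem y) //= dvdp_mulr.
Qed.

Lemma horner_trig_mx (R : comNzRingType) n (U : 'M[R]_n.+1) (p : {poly R}) :
  is_trig_mx U ->
  is_trig_mx (horner_mx U p) /\ forall i, horner_mx U p i i = p.[U i i].
Proof.
move=> /is_trig_mxP Ut; elim/poly_ind: p => [|p c [/is_trig_mxP IHt IHd]].
  by rewrite rmorph0; split=> [|i]; rewrite ?mx0_is_trig // mxE horner0.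
rewrite rmorphD rmorphM /= horner_mx_X horner_mx_C; split=> [|i].
  apply/is_trig_mxP => i j ij; rewrite !mxE -val_eqE /= ltn_eqF // addr0.
  rewrite big1 // => k _; have [ik|ki] := ltnP i k; first by rewrite IHt ?mul0r.
  by rewrite (Ut k) ?mulr0 // (leq_ltn_trans ki).
rewrite !mxE eqxx !hornerE (bigD1 i) //= IHd big1 ?addr0 // => k ki.
have [ik|ki'] := ltnP i k; first by rewrite IHt ?mul0r.
by rewrite (Ut k) ?mulr0 // ltn_neqAle ki' andbT.
Qed.

(** Powers of distinct linear factors are coprime, so their kernels add up to the kernel of the
    product. [undup] merges repeated roots; no multiplicity exceeds [size s], so one exponent [N]
    serves them all. *)
Lemma kermxpoly_split_sum (F : fieldType) n (T : 'M[F]_n.+1) (s : seq F) N :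
  (size s <= N)%N -> horner_mx T (\prod_(x <- s) ('X - x%:P)) = 0 ->
  (1%:M <= \sum_(i < size (undup s))
     kermxpoly T (('X - (nth 0 (undup s) i)%:P) ^+ N))%MS.
Proof.
move=> sN; rewrite -prodr_undup_exp_count (big_nth 0) big_mkord => T0.
rewrite -kermxpoly_prod; last first.
  move=> i j _ _ ij; rewrite coprimep_expl // coprimep_expr //.
  by rewrite coprimep_XsubC root_XsubC nth_uniq ?undup_uniq.
apply/sub_kermxP; rewrite mul1mx.
have /dvdpP[q ->] : \prod_(i < size (undup s))
    ('X - (nth 0 (undup s) i)%:P) ^+ count_mem (nth 0 (undup s) i) s %|
  \prod_(i < size (undup s)) ('X - (nth 0 (undup s) i)%:P) ^+ N.
  elim/big_ind2: _ => [|? ? ? ?|i _]; [exact: dvdpp|exact: dvdp_mul|].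
  by rewrite dvdp_exp2l // (leq_trans (count_size _ _)).
by rewrite rmorphM /= T0 mulr0.
Qed.

Section ConjugateDerivation.
Variables (C : numClosedFieldType) (n : nat).
Variables (T : 'M[C]_n.+1) (ad : {linear 'rV[C]_n.+1 -> 'M[C]_n.+1}).
(** Vectors are rows and matrices act on the right: with [w *m ad v] read as the bracket [v, w],
    this is the Leibniz rule for [T]. *)
Hypothesis T_der : forall z, ad (z *m T) = ad z *m T - T *m ad z.

Lemma shift_der (x y : C) (v w : 'rV[C]_n.+1) :
  w *m ad v *m (T - (x + y)%:M) =
  w *m ad (v *m (T - x%:M)) + w *m (T - y%:M) *m ad v.
Proof.
have E (c : C) (u : 'rV_n.+1) : u *m (T - c%:M) = u *m T - c *: u.
  by rewrite mulmxBr mul_mx_scalar.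
have adZ (c : C) u : ad (c *: u) = c *: ad u by rewrite linearZ.
rewrite !E linearB adZ T_der mulmxBl !mulmxBr -scalemxAr -scalemxAl.
rewrite !mulmxA scalerDl opprD addrA [RHS]addrA; congr (_ + _).
by rewrite [RHS]addrAC subrK.
Qed.

(** By [shift_der], each factor [T - (x + y)%:M] lowers the exponent of one of the two vectors;
    after [a + b] factors every term has a zero argument. *)
Lemma geigen_bracket (x y : C) a b (v w : 'rV[C]_n.+1) :
  v *m (T - x%:M) ^+ a = 0 -> w *m (T - y%:M) ^+ b = 0 ->
  w *m ad v *m (T - (x + y)%:M) ^+ (a + b) = 0.
Proof.
move: {2}(a + b)%N (leqnn (a + b)) => m.
elim: m a b v w => [|m IH] [|a] [|b] v w // le_ab v0 w0;
  rewrite ?expr0 ?mulmx1 in v0 w0; subst; rewrite ?linear0 ?mulmx0 ?mul0mx //.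
move: le_ab; rewrite addSn addnS !ltnS => le_ab.
rewrite exprS mulmxA shift_der mulmxDl.
rewrite exprS mulmxA in v0; rewrite exprS mulmxA in w0.
rewrite -{1}addnS IH ?addnS ?add0r //; last by rewrite exprS mulmxA.
by rewrite -addSn IH ?addSn // exprS mulmxA.
Qed.

Lemma conjugate_derivation_succ : exists S,
  (forall z, ad (z *m S) = ad z *m S - S *m ad z) /\
  (\tr (T *m S) = 0 -> exists k, T ^+ k = 0).
Proof.
have [P /unitarymx_unit Pu Ut] := Schur T (ltn0Sn n).
have [U {}Ut TE] : exists2 U, is_trig_mx U & T = invmx P *m U *m P.
  by exists (conjmx P T); rewrite // conjumx // !mulmxA mulVmx // mul1mx mulmxKV.
pose s := [seq U i i | i <- enum 'I_n.+1].
have sz_s : size s = n.+1 by rewrite size_map size_enum_ord.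
(* Sums are included because the bracket of generalized eigenvectors for [x] and [y] belongs to
   [x + y]; the doubled exponent below is the one [geigen_bracket] gives. *)
pose l := s ++ [seq x + y | x <- s, y <- s].
have [p pE] := poly_interpolation (fun x => x^*) (n.+1 + n.+1) l.
have T0 : horner_mx T (\prod_(x <- s) ('X - x%:P)) = 0.
  rewrite big_map big_enum -(char_poly_trig Ut) TE horner_mx_uconjC //.
  by rewrite Cayley_Hamilton mulmx0 mul0mx.
have actE x (v : 'rV_n.+1) : x \in l -> v *m (T - x%:M) ^+ (n.+1 + n.+1) = 0 ->
    v *m horner_mx T p = x^* *: v.
  move=> /pE /dvdpP[q] /(congr1 (horner_mx T)) + v0.
  rewrite mulrC rmorphM rmorphXn !rmorphB /= horner_mx_X !horner_mx_C.
  move=> /(congr1 (mulmx v)); rewrite mulmxBr mul_mx_scalar mulmxA v0 mul0mx.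
  by move/eqP; rewrite subr_eq0 => /eqP.
exists (horner_mx T p); split=> [z|].
  have gsum (v : 'rV_n.+1) : exists u_ : 'I_(size (undup s)) -> 'rV_n.+1,
      v = \sum_i u_ i /\ forall i, u_ i *m (T - ((undup s)`_i)%:M) ^+ n.+1 = 0.
    have := kermxpoly_split_sum (eq_leq sz_s) T0.
    move=> /(submx_trans (submx1 v))/sub_sumsmxP[u_ ->].
    exists (fun i => u_ i *m kermxpoly T (('X - ((undup s)`_i)%:P) ^+ n.+1)).
    split=> // i; rewrite -mulmxA /kermxpoly rmorphXn rmorphB /= horner_mx_X.
    by rewrite horner_mx_C mulmx_ker mulmx0.
  have undup_s i : (i < size (undup s))%N -> (undup s)`_i \in s.
    by move=> lt_i; rewrite -mem_undup mem_nth.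
  have wider x (v : 'rV_n.+1) : v *m (T - x%:M) ^+ n.+1 = 0 ->
      v *m (T - x%:M) ^+ (n.+1 + n.+1) = 0.
    by move=> v0; rewrite exprD mulmxA v0 mul0mx.
  pose S := horner_mx T p; rewrite -/S.
  (* On generalized eigenvectors the Leibniz rule for [S] is the additivity of conjugation; the
     general case follows by decomposing both arguments. *)
  have eigE i j (v w : 'rV_n.+1) :
      v *m (T - ((undup s)`_i)%:M) ^+ n.+1 = 0 -> (i < size (undup s))%N ->
      w *m (T - ((undup s)`_j)%:M) ^+ n.+1 = 0 -> (j < size (undup s))%N ->
      w *m ad (v *m S) = w *m ad v *m S - w *m S *m ad v.
    move=> v0 /undup_s si w0 /undup_s sj.
    rewrite (actE _ _ _ (wider _ _ v0)) ?mem_cat ?si //.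
    rewrite (actE _ _ _ (wider _ _ w0)) ?mem_cat ?sj //.
    rewrite (actE _ _ _ (geigen_bracket v0 w0)) ?mem_cat; last first.
      by rewrite orbC (introT allpairsP) //; exists ((undup s)`_i, (undup s)`_j).
    have adZ (c : C) u : ad (c *: u) = c *: ad u by rewrite linearZ.
    by rewrite adZ -scalemxAr -scalemxAl rmorphD scalerDl addrK.
  have [z_ [-> z0]] := gsum z.
  rewrite mulmx_suml 2!(linear_sum ad) /= mulmx_suml mulmx_sumr -sumrB.
  apply/row_matrixP => j; rewrite !rowE.
  have [w_ [-> w0]] := gsum (delta_mx 0 j).
  rewrite [LHS]mulmx_sumr [RHS]mulmx_sumr; apply: eq_bigr => i _.
  rewrite mulmxBr !mulmxA !mulmx_suml -sumrB.
  by apply: eq_bigr => k _; apply: (eigE i k).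
(* [T *m S] is similar to ['X * p] evaluated at the triangular [U], whose diagonal entries are the
   squared moduli of the eigenvalues. *)
rewrite -[X in X *m _](horner_mx_X T) mulmxE -rmorphM /= TE horner_mx_uconjC //.
rewrite mxtrace_mulC mulmxA mulmxV // mul1mx.
have [_ Ud] := horner_trig_mx ('X * p) Ut.
rewrite /mxtrace (eq_bigr (fun i => `|U i i| ^+ 2)) => [|i _]; last first.
  rewrite Ud !hornerE normCK; congr (_ * _).
  have /pE : U i i \in l.
    by rewrite mem_cat; apply/orP; left; apply/mapP; exists i; rewrite ?mem_enum.
  case/dvdpP => q /(congr1 (horner^~ (U i i))); rewrite !hornerE subrr.
  by rewrite expr0n mulr0 => /eqP; rewrite subr_eq0 => /eqP.
move=> /eqP; rewrite psumr_eq0 => [/allP U0|i _]; last by rewrite exprn_ge0.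
(* All eigenvalues being zero, the Cayley-Hamilton identity [T0] reads [T ^+ n.+1 = 0]. *)
exists n.+1; rewrite -TE -(horner_mx_X T) -rmorphXn /= -[RHS]T0 big_map big_enum /=.
congr (horner_mx _ _); rewrite (eq_bigr (fun=> 'X)) ?prodr_const ?card_ord // => i _.
have := U0 i (mem_index_enum i); rewrite /= sqrf_eq0 normr_eq0 => /eqP ->.
by rewrite subr0.
Qed.

End ConjugateDerivation.

(* The [S] constructed here acts as the conjugate of the eigenvalue on each
   generalized eigenspace of [T], so that [\tr (T *m S)] is the sum of the squared
   moduli of the eigenvalues. *)
Lemma conjugate_derivation (C : numClosedFieldType) n (T : 'M[C]_n)
    (ad : {linear 'rV[C]_n -> 'M[C]_n}) :
  (forall z, ad (z *m T) = ad z *m T - T *m ad z) -> exists S,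
  (forall z, ad (z *m S) = ad z *m S - S *m ad z) /\
  (\tr (T *m S) = 0 -> exists k, T ^+ k = 0).
Proof.
case: n T ad => [|n] T ad Tder; last exact: conjugate_derivation_succ Tder.
by exists 0; split=> [z|_]; [|exists 1%N]; rewrite [LHS]thinmx0 [RHS]thinmx0.
Qed.

(** * Engel's theorem *)

Section Engel.
Variables (R : realType) (V : vectType R) (mu : bilin V).
Hypothesis mu_lie : lie_bracket mu.
Implicit Types (x y z v w : V) (D N U W : {vspace V}).

Definition ad_nilpotent x := exists k, forall v, iter k (mu x) v = 0.

Definition acts_on N W := forall x w, x \in N -> w \in W -> mu x w \in W.

(** Engel's theorem for the action of [N] on [W / W'], phrased without quotients: [N] kills some
    nonzero class. *)
Definition engel_property N := forall W W', (W' <= W)%VS -> ~~ (W <= W')%VS ->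
  acts_on N W -> acts_on N W' ->
  exists w, [/\ w \in W, w \notin W' & forall x, x \in N -> mu x w \in W'].

Lemma lie_bracketxx x : mu x x = 0.
Proof.
have /eqP := mu_lie.1 x x.
by rewrite -addr_eq0 -mulr2n -scaler_nat scaler_eq0 pnatr_eq0 => /eqP.
Qed.

Lemma lie_bracket_bracket x y z : mu (mu x y) z = mu x (mu y z) - mu y (mu x z).
Proof.
have /eqP := mu_lie.2 x y z.
rewrite addrC addr_eq0 mu_lie.1 eqr_oppLR => /eqP ->.
by rewrite opprK (mu_lie.1 z x) linearN.
Qed.

Lemma dimv_add_line N z : z \notin N -> \dim (N + <[z]>) = (\dim N).+1.
Proof.
move=> zN; have z0 : z != 0 by apply: contraNneq zN => ->; rewrite mem0v.
rewrite dimv_disjoint_sum ?dim_vline ?z0 ?addn1 //.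
apply/eqP; rewrite -subv0; apply/subvP => y.
rewrite memv_cap => /andP[yN /vlineP[a ya]]; move: yN; rewrite {}ya.
have [->|a0] := eqVneq a 0; first by rewrite scale0r !mem0v.
by rewrite rpredZeq (negPf zN) (negPf a0).
Qed.

Lemma acts_on_add_line N z : acts_on N N -> (forall x, x \in N -> mu x z \in N) ->
  forall x y, x \in (N + <[z]>)%VS -> y \in (N + <[z]>)%VS -> mu x y \in N.
Proof.
move=> NN Nz u v /memv_addP[x xN [_ /vlineP[a ->] ->]].
move=> /memv_addP[y yN [_ /vlineP[b ->] ->]].
rewrite !linearD !linearZ /= !add_lfunE !scale_lfunE.
rewrite lie_bracketxx scaler0 addr0 (mu_lie.1 z) scalerN.
by apply: memvD; [apply: memvB; [exact: NN|apply/memvZ/Nz]|apply/memvZ/Nz].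
Qed.

Lemma engel_property0 : engel_property 0%VS.
Proof.
move=> W W' _ /subvPn[w wW wW'] _ _; exists w; split=> // x.
by rewrite memv0 => /eqP ->; rewrite linear0 lfunE /= mem0v.
Qed.

(* The vector found for [N] is pushed by [ad z] until it is about to enter
   [W']; normality of [N] in [N + <[z]>] keeps it annihilated by [N] modulo [W']. *)
Lemma engel_property_add_line N z : ad_nilpotent z ->
  (forall x, x \in N -> mu x z \in N) ->
  engel_property N -> engel_property (N + <[z]>)%VS.
Proof.
move=> [k zk] Nz EN W W' sW' nW aW aW'.
have sN x : x \in N -> x \in (N + <[z]>)%VS by apply/subvP/addvSl.
have zz : z \in (N + <[z]>)%VS by apply: (subvP (addvSr _ _)); exact: memv_line.
have [x w /sN|x w /sN|u [uW uW' Nu]] := EN W W' sW' nW; [exact: aW|exact: aW'|].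
have iterW i : iter i (mu z) u \in W by elim: i => //= i; apply: aW.
have iterN i x : x \in N -> mu x (iter i (mu z) u) \in W'.
  elim: i x => [|i IH] x xN /=; first exact: Nu.
  have -> : mu x (mu z (iter i (mu z) u)) =
      mu (mu x z) (iter i (mu z) u) + mu z (mu x (iter i (mu z) u)).
    by rewrite lie_bracket_bracket subrK.
  by rewrite memvD ?IH ?Nz // aW' ?IH.
have ex : exists i, iter i (mu z) u \in W' by exists k; rewrite zk mem0v.
case: (ex_minnP ex) => -[|i] /= zi min_i; first by rewrite zi in uW'.
exists (iter i (mu z) u); split=> //.
  by apply/negP => /min_i; rewrite ltnn.
move=> _ /memv_addP[x xN [_ /vlineP[a ->] ->]].
by rewrite linearD linearZ /= add_lfunE scale_lfunE memvD ?iterN ?memvZ.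
Qed.

(** A subalgebra of [D] with the property is enlarged by one dimension at a time until it fills
    [D]. *)
Lemma engel D : acts_on D D -> (forall x, x \in D -> ad_nilpotent x) ->
  engel_property D.
Proof.
move=> DD nilD; suff H k : (k <= \dim D)%N -> exists N,
    [/\ (N <= D)%VS, \dim N = k, acts_on N N & engel_property N].
  have [N [sND /eqP dN _ EN]] := H _ (leqnn _).
  by have /eqP <- : N == D by rewrite eqEdim sND (eqP dN) leqnn.
elim: k => [_|k IH ltk].
  exists 0%VS; split; rewrite ?sub0v ?dimv0 //; last exact: engel_property0.
  by move=> x w _; rewrite memv0 => /eqP ->; rewrite linear0 mem0v.
have [N [sND dN NN EN]] := IH (ltnW ltk).
have sub x : x \in N -> x \in D by apply/subvP.
have nDN : ~~ (D <= N)%VS by apply: contraL ltk => /dimvS; rewrite dN -ltnNge.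
(* The property of [N], applied to [D / N], supplies a [z] outside [N] that normalizes [N]. *)
have [x w /sub|//|z [zD zN Nz]] := EN D N sND nDN; first exact: DD.
exists (N + <[z]>)%VS; split.
- by rewrite subv_add sND -memvE.
- by rewrite dimv_add_line ?dN.
- move=> x y xN yN; apply: (subvP (addvSl N <[z]>)).
  exact: (acts_on_add_line NN Nz xN yN).
- exact: engel_property_add_line (nilD _ zD) Nz EN.
Qed.

(** [D] stabilizes a chain of subspaces growing by one dimension and acts by zero on each successive
    quotient; the member of codimension one thus contains [D, D]. *)
Lemma engel_not_perfect D : acts_on D D -> (forall x, x \in D -> ad_nilpotent x) ->
  D != 0%VS -> (\dim (bracketv mu D D) < \dim D)%N.
Proof.
move=> DD nilD D0; have ED := engel DD nilD.
have step W : (W <= D)%VS -> (\dim W < \dim D)%N -> acts_on D W ->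
    exists2 w, w \in D & w \notin W /\
      forall x y, x \in D -> y \in (W + <[w]>)%VS -> mu x y \in W.
  move=> sW ltW DW; have nW : ~~ (D <= W)%VS.
    by apply: contraL ltW => /dimvS; rewrite -leqNgt.
  have [w [wD wW Dw]] := ED D W sW nW DD DW; exists w => //; split=> //.
  move=> x _ xD /memv_addP[y yW [_ /vlineP[a ->] ->]].
  by rewrite linearD linearZ /= memvD ?DW ?memvZ ?Dw.
have H k : (k < \dim D)%N -> exists W,
    [/\ (W <= D)%VS, \dim W = k & acts_on D W].
  elim: k => [_|k IH ltk].
    exists 0%VS; rewrite sub0v dimv0; split=> // x w _.
    by rewrite memv0 => /eqP ->; rewrite linear0 mem0v.
  have [W [sW dW DW]] := IH (ltnW ltk).
  have [||w wD [wW Dw]] := step W sW; rewrite ?dW //; first exact: ltnW.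
  exists (W + <[w]>)%VS; rewrite subv_add sW -memvE wD dimv_add_line // dW.
  split=> // x y xD yW; apply: (subvP (addvSl W <[w]>)); exact: Dw.
have dD : (0 < \dim D)%N by rewrite lt0n dimv_eq0.
have [|W [sW dW DW]] := H (\dim D).-1; first by rewrite prednK.
have ltW : (\dim W < \dim D)%N by rewrite dW prednK.
have [w wD [wW Dw]] := step W sW ltW DW.
have /eqP WwD : (W + <[w]> == D)%VS.
  by rewrite eqEdim subv_add sW -memvE wD dimv_add_line // dW prednK /=.
apply: leq_ltn_trans ltW; apply/dimvS/bracketv_subP => x y xD yD.
by apply: Dw; rewrite ?WwD.
Qed.

Lemma derived_series_acts U k : acts_on U U ->
  acts_on (derived_series mu U k) (derived_series mu U k).
Proof.
move=> UU; elim: k => [//|k IH] /= x y xD yD; apply: (bracketv_subP _ _ _ _ (subvv _)).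
  by apply: (subvP _ _ xD); apply/bracketv_subP.
by apply: (subvP _ _ yD); apply/bracketv_subP.
Qed.

(** Ad-nilpotency is given on [U, U] only, so the dimensions are shown to drop strictly from the
    first derived term on; hence the index shift in [dimD] and the extra step in the witness. *)
Lemma lie_solvable_ad_nilpotent U : acts_on U U ->
  (forall x, x \in bracketv mu U U -> ad_nilpotent x) -> lie_solvable mu U.
Proof.
move=> UU nilU; pose D k := derived_series mu U k.
have sD k : (D k.+1 <= D k)%VS.
  by apply/bracketv_subP; exact: (derived_series_acts (k := k) UU).
have sD1 k : (D k.+1 <= D 1)%VS.
  by elim: k => [|k IH]; [exact: subvv|exact: subv_trans (sD _) IH].
have dimD k : (\dim (D k.+1) <= \dim U - k)%N.
  elim: k => [|k IH]; first by rewrite subn0; apply: dimvS; apply: (sD 0%N).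
  (* Strict decrease requires a nonzero term; after a zero term the series stays zero. *)
  have [D0|D0] := eqVneq (D k.+1) 0%VS.
    by move: (dimvS (sD k.+1)); rewrite D0 dimv0 leqn0 => /eqP ->.
  rewrite subnS -ltnS (leq_trans _ (leqSpred _)) // (leq_trans _ IH) //.
  apply: engel_not_perfect => //; first exact: (derived_series_acts (k := k.+1) UU).
  by move=> x /(subvP (sD1 k)); apply: nilU.
exists (\dim U).+1; apply/eqP; rewrite -dimv_eq0 -leqn0.
by rewrite (leq_trans (dimD _)) // subnn.
Qed.

Lemma bracketv_ind U W (P : V -> Prop) : P 0 ->
  (forall x y, P x -> P y -> P (x + y)) ->
  (forall x y, x \in U -> y \in W -> P (mu x y)) ->
  forall x, x \in bracketv mu U W -> P x.
Proof.
move=> P0 PD PB; have Ub x : x \in (vbasis U : seq V) -> x \in U by apply: vbasis_mem.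
rewrite /bracketv; elim: (vbasis U : seq V) Ub => [|X s IH] Ub x.
  by rewrite big_nil memv0 => /eqP ->.
rewrite big_cons => /memv_addP[_ /memv_imgP[y yW ->] [z zs ->]].
apply: PD; first by apply: PB => //; apply: Ub; rewrite mem_head.
by apply: IH zs => w ws; apply: Ub; rewrite inE ws orbT.
Qed.

End Engel.

(** * The Killing form *)

Section KillingForm.
Variables (R : realType) (V : vectType R).
Implicit Types (mu : bilin V) (x y z v : V).
Local Notation n := (\dim {:V}).
Local Notation e := (vbasis {:V}).
Local Notation rV := (rVof e).

Let eB : basis_of {:V} e := vbasisP _.

Definition ad_mx mu x : 'M[R]_n := mxof e e (mu x).

Lemma ad_mx_linear mu : linear (ad_mx mu).
Proof. by move=> a x y; rewrite /ad_mx !linearP. Qed.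

HB.instance Definition _ mu := GRing.isSemilinear.Build R V 'M[R]_n _ (ad_mx mu)
  (GRing.semilinear_linear (ad_mx_linear mu)).

Definition killing mu x y : R := \tr (ad_mx mu x *m ad_mx mu y).

Definition killing_gram mu : 'M[R]_n := \matrix_(i, j) killing mu e`_i e`_j.

Lemma mul_rVof_ad_mx mu x v : rV v *m ad_mx mu x = rV (mu x v).
Proof. by rewrite -rVof_app. Qed.

(** The right action on rows reverses composition, hence the order of the commutator. *)
Lemma ad_mx_bracket mu x y : lie_bracket mu ->
  ad_mx mu (mu x y) = ad_mx mu y *m ad_mx mu x - ad_mx mu x *m ad_mx mu y.
Proof.
move=> lie; rewrite /ad_mx -!(mxof_comp _ _ eB) -linearB; congr (mxof _ _ _).
by apply/lfunP => z; rewrite lie_bracket_bracket // add_lfunE opp_lfunE !comp_lfunE.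
Qed.

Lemma killing_invariant mu x y z : lie_bracket mu ->
  killing mu (mu z x) y = - killing mu x (mu z y).
Proof.
move=> lie; rewrite /killing !ad_mx_bracket // mulmxBl mulmxBr.
rewrite 2!(raddfB mxtrace) /= opprB.
by rewrite -!mulmxA (mxtrace_mulC (ad_mx mu z)) -!mulmxA.
Qed.

Lemma killing_gramE mu x y :
  killing mu x y = (rV x *m killing_gram mu *m (rV y)^T) 0 0.
Proof.
rewrite {1}(coord_basis eB (memvf x)) {1}(coord_basis eB (memvf y)).
rewrite /killing 2!(linear_sum (ad_mx mu)) mulmx_suml (raddf_sum mxtrace) [RHS]mxE.
under [RHS]eq_bigr do rewrite !mxE mulr_suml.
rewrite [RHS]exchange_big; apply: eq_bigr => i _ /=.
rewrite mulmx_sumr (raddf_sum mxtrace); apply: eq_bigr => j _.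
rewrite 2!(linearZ_LR (ad_mx mu)) /= -scalemxAl -scalemxAr scalerA mxtraceZ.
rewrite !mxE /killing.
by rewrite mulrAC.
Qed.

(** Writing the radical as the kernel of the endomorphism with the Gram matrix makes it a subspace
    by construction. *)
Definition killing_radical mu : {vspace V} := lker (hommx e e (killing_gram mu)).

Lemma killing_radicalP mu x :
  reflect (forall y, killing mu x y = 0) (x \in killing_radical mu).
Proof.
rewrite memv_ker (hommxE eB eB) (vecof_eq0 eB); apply: (iffP eqP) => [x0 y|x0].
  by rewrite killing_gramE x0 mul0mx mxE.
apply/rowP => j; rewrite [RHS]mxE; have := x0 e`_j.
by rewrite killing_gramE (rVofE eB) trmx_delta -colE mxE.
Qed.

Lemma killing_radical_ideal mu : lie_bracket mu -> lie_ideal mu (killing_radical mu).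
Proof.
move=> lie z x /killing_radicalP x0; apply/killing_radicalP => y.
by rewrite killing_invariant // x0 oppr0.
Qed.

Lemma rVof_iter_ad mu x k v : rV (iter k (mu x) v) = rV v *m ad_mx mu x ^+ k.
Proof.
elim: k => [|k IH] /=; first by rewrite expr0 mulmx1.
by rewrite -mul_rVof_ad_mx IH exprSr mulmxA.
Qed.

Section Complexification.
Variable mu : bilin V.
Hypothesis mu_lie : lie_bracket mu.
Local Notation C := (complex R).
Local Notation toC := (map_mx (real_complex R)).

(** The complex-linear extension of [ad_mx mu] to coordinate vectors, written as a product with a
    matrix of flattened adjoint matrices so that linearity is inherited. *)
Definition adC : 'rV[C]_n -> 'M[C]_n :=
  vec_mx \o mulmxr (\matrix_i mxvec (toC (ad_mx mu e`_i))).

HB.instance Definition _ := GRing.Linear.on adC.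

Lemma adCE u : adC u = \sum_i u 0 i *: toC (ad_mx mu e`_i).
Proof.
rewrite /adC /= mulmx_sum_row linear_sum; apply: eq_bigr => i _.
by rewrite linearZ /= rowK mxvecK.
Qed.

Lemma adC_real x : adC (toC (rV x)) = toC (ad_mx mu x).
Proof.
rewrite adCE [in RHS](coord_basis eB (memvf x)) (linear_sum (ad_mx mu)).
rewrite (raddf_sum (map_mx _)); apply: eq_bigr => i _ /=.
by rewrite (linearZ_LR (ad_mx mu)) map_mxZ !mxE.
Qed.

(** By linearity in [u] it suffices to treat the real basis, where this is the Jacobi identity. *)
Lemma adC_derivation x u :
  adC (u *m toC (ad_mx mu x)) =
  adC u *m toC (ad_mx mu x) - toC (ad_mx mu x) *m adC u.
Proof.
rewrite [u in LHS]row_sum_delta mulmx_suml (linear_sum adC) adCE.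
rewrite mulmx_suml mulmx_sumr -sumrB; apply: eq_bigr => i _.
rewrite -!scalemxAl (linearZ_LR adC) -scalemxAr -scalerBr; congr (_ *: _) => /=.
have -> : delta_mx 0 i = toC (rV e`_i) by rewrite (rVofE eB) map_delta_mx.
by rewrite -map_mxM mul_rVof_ad_mx adC_real ad_mx_bracket // map_mxB !map_mxM.
Qed.

Lemma killing_radical_ad_nilpotent x :
  x \in bracketv mu (killing_radical mu) (killing_radical mu) ->
  ad_nilpotent mu x.
Proof.
move=> x_der.
have [S [Sder Snil]] := conjugate_derivation (adC_derivation x).
suff trS : \tr (toC (ad_mx mu x) *m S) = 0.
  have [k Tk] := Snil trS.
  have mapX (A : 'M[R]_n) : toC (A ^+ k) = toC A ^+ k.
    by elim: k {Tk} => [|k IH]; rewrite ?expr0 ?map_mx1 // !exprS -IH [LHS]map_mxM.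
  exists k => v; apply/eqP; rewrite -(rVof_eq0 eB) rVof_iter_ad.
  by move/eqP: Tk; rewrite -mapX map_mx_eq0 => /eqP ->; rewrite mulmx0.
(* [adC u] is a complex combination of real adjoint matrices, so orthogonality to real vectors
   extends to complex ones. *)
have radC y u : y \in killing_radical mu -> \tr (toC (ad_mx mu y) *m adC u) = 0.
  move=> /killing_radicalP y0; rewrite adCE mulmx_sumr (raddf_sum mxtrace).
  rewrite big1 // => i _ /=; rewrite -scalemxAr mxtraceZ -map_mxM trace_map_mx.
  by have := y0 e`_i; rewrite /killing => ->; rewrite mulr0.
apply: (bracketv_ind (P := fun w => \tr (toC (ad_mx mu w) *m S) = 0)) x_der.
- by rewrite linear0 map_mx0 mul0mx linear0.
- by move=> y z y0 z0; rewrite linearD map_mxD mulmxDl mxtraceD y0 z0 addr0.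
move=> y z y_rad _; rewrite ad_mx_bracket // map_mxB !map_mxM mulmxBl.
(* With Y and Z the matrices of ad y and ad z, cyclicity gives tr((Z Y - Y Z) S) = tr(Y (S Z - Z
   S)), and [Sder] makes the last factor minus [adC] of the image of [z] under [S]. *)
rewrite raddfB /= -mulmxA mxtrace_mulC -mulmxA -mulmxA -raddfB -mulmxBr /=.
rewrite -[X in S *m X - _]adC_real -[X in _ - X *m S]adC_real -[X in _ *m X]opprB.
by rewrite -Sder mulmxN raddfN /= radC // oppr0.
Qed.

End Complexification.

Lemma det_killing_gram_neq0 mu : lie_bracket mu -> semisimple mu ->
  \det (killing_gram mu) != 0.
Proof.
move=> lie ss; apply/negP => /det0P[v v0 vG].
have rad0 : killing_radical mu = 0%VS.
  apply: ss; first exact: killing_radical_ideal.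
  apply: lie_solvable_ad_nilpotent => //.
    by move=> x y _; apply: killing_radical_ideal.
  exact: killing_radical_ad_nilpotent.
have : vecof e v \in killing_radical mu.
  by rewrite memv_ker (hommxE eB eB) (vecofK eB) vG linear0.
by rewrite rad0 memv0 (vecof_eq0 eB) (negPf v0).
Qed.

End KillingForm.

(** * Orbits and their closures *)

(** If [f x] differed from [c], the preimage under the coordinate map of an open set would be a
    neighbourhood of [x] missing [S]. Continuity is asked in coordinates because the topology is
    initial for that map. *)
Lemma closure_usual_topology_const (R : realType) (W : vectType R) (S : set W)
    (x : W) (f : W -> R) (c : R) :
  continuous (fun u : 'rV[R]_(\dim {:W}) => f (vecof (vbasis {:W}) u)) ->
  (forall y, S y -> f y = c) -> closure (S : set (usual_topology W)) x -> f x = c.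
Proof.
move=> cf Sc clS; apply/eqP/negP => /negP fxc.
pose r : W -> 'rV[R]_(\dim {:W}) := rVof (vbasis {:W}).
have rK y : vecof (vbasis {:W}) (r y) = y by apply: rVofK; exact: vbasisP.
have nf : nbhs (r x) [set u | f (vecof (vbasis {:W}) u) != c].
  have op : open (~` [set c]) by exact/closed_openC/closed_eq.
  apply: (cf (r x) [set d | d != c]); rewrite rK.
  by apply: filterS (open_nbhs_nbhs (conj op (elimN eqP fxc))) => d /eqP.
have nx : nbhs (x : usual_topology W) (r @^-1` [set u | f (vecof (vbasis {:W}) u) != c]).
  exact: (@initial_continuous _ _ r x _ nf).
have [y [/Sc yc /=]] := clS _ nx.
by rewrite rK yc eqxx.
Qed.

Section Topology.
Variables (R : realType) (V : vectType R).
Local Notation n := (\dim {:V}).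
Local Notation e := (vbasis {:V}).

Let eB : basis_of {:V} e := vbasisP _.

Lemma mxof_lfun_inv (A : 'End(V)) : lker A = 0%VS ->
  mxof e e (A^-1)%VF *m mxof e e A = 1%:M.
Proof.
move=> A0; rewrite -(mxof_comp _ _ eB) -(mxof1 (basis_free eB)).
congr (mxof _ _ _); apply/lfunP => v; rewrite comp_lfunE id_lfunE.
by apply: lker0_lfunVK; rewrite A0.
Qed.

(** [A] is an isomorphism from [lie_act A mu] to [mu], so it conjugates adjoint matrices, and traces
    ignore conjugation. *)
Lemma killing_lie_act (A : 'End(V)) mu x y : lker A = 0%VS ->
  killing (lie_act A mu) x y = killing mu (A x) (A y).
Proof.
move=> A0; have AV := mxof_lfun_inv A0.
have adE z : ad_mx (lie_act A mu) z =
    mxof e e A *m ad_mx mu (A z) *m mxof e e (A^-1)%VF.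
  rewrite /ad_mx -!(mxof_comp _ _ eB); congr (mxof _ _ _); apply/lfunP => v.
  by rewrite lie_actE !comp_lfunE.
rewrite /killing !adE mxtrace_mulC !mulmxA -(mulmxA _ _ (mxof e e A)) AV mulmx1.
by rewrite mxtrace_mulC !mulmxA AV mul1mx mxtrace_mulC.
Qed.

Lemma form_row_baseE m (B M : 'M[R]_m) i j :
  (delta_mx 0 i *m M *m B *m (delta_mx (0 : 'I_1) j *m M)^T) (0 : 'I_1) 0 =
  (M *m B *m M^T) i j.
Proof. by rewrite trmx_mul trmx_delta !mulmxA -colE -!mulmxA -rowE !mxE. Qed.

Lemma killing_gram_lie_act (A : 'End(V)) mu : lker A = 0%VS ->
  killing_gram (lie_act A mu) =
  mxof e e A *m killing_gram mu *m (mxof e e A)^T.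
Proof.
move=> A0; apply/matrixP => i j; rewrite mxE killing_lie_act // killing_gramE.
by rewrite !(rVof_app e eB) !(rVofE eB) form_row_baseE.
Qed.

Lemma symmetric_gramE (g : {symmetric V}) x y :
  g x y = (rVof e x *m (\matrix_(i, j) g e`_i e`_j) *m (rVof e y)^T) 0 0.
Proof.
rewrite {1}(coord_basis eB (memvf x)) {1}(coord_basis eB (memvf y)).
rewrite linear_sumlz [RHS]mxE.
under [RHS]eq_bigr do rewrite !mxE mulr_suml.
rewrite [RHS]exchange_big; apply: eq_bigr => i _ /=.
rewrite linear_sumr; apply: eq_bigr => j _.
by rewrite linearZlr /= !mxE mulrA mulrAC.
Qed.

(** Invariance of [g] reads M G M^T = G for M the matrix of [A] and G the Gram matrix, and
    nondegeneracy allows cancelling det G. *)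
Lemma det_isometry (g : {symmetric V}) (A : 'End(V)) : nondegenerate g ->
  isometry_group g A -> \det (mxof e e A) ^+ 2 = 1.
Proof.
move=> /eqP gnd [A0 gA]; pose G : 'M[R]_n := \matrix_(i, j) g e`_i e`_j.
have detG : \det G != 0.
  apply/negP => /det0P[v v0 vG].
  have : vecof e v \in orthov g fullv.
    apply/mem_orthovP => y _.
    by rewrite symmetric_gramE (vecofK eB) vG mul0mx mxE.
  by rewrite gnd memv0 (vecof_eq0 eB) (negPf v0).
have GE : mxof e e A *m G *m (mxof e e A)^T = G.
  apply/matrixP => i j; rewrite [RHS]mxE -gA symmetric_gramE !(rVof_app e eB).
  by rewrite !(rVofE eB) form_row_baseE.
move/(congr1 determinant): GE; rewrite !det_mulmx det_tr => /eqP.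
rewrite mulrAC -expr2 -[X in _ == X]mul1r => /eqP.
by apply: mulIf.
Qed.

Lemma det_killing_gram_orbit (g : {symmetric V}) mu nu : nondegenerate g ->
  lie_orbit g mu nu -> \det (killing_gram nu) = \det (killing_gram mu).
Proof.
move=> gnd [A gA ->]; rewrite killing_gram_lie_act; last by case: gA.
by rewrite !det_mulmx det_tr mulrAC -expr2 (det_isometry gnd gA) mul1r.
Qed.

(** * Continuity of the determinant of the Killing form *)

Local Notation N := (\dim {:bilin V}).
Local Notation b := (vbasis {:bilin V}).

Lemma continuous_sum (T : topologicalType) (I : finType) (F : I -> T -> R) :
  (forall i, continuous (F i)) -> continuous (fun x => \sum_i F i x).
Proof. by move=> cF; apply: continuous_big => //; exact: add_continuous. Qed.

Lemma continuous_prod (T : topologicalType) (I : finType) (F : I -> T -> R) :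
  (forall i, continuous (F i)) -> continuous (fun x => \prod_i F i x).
Proof. by move=> cF; apply: continuous_big => //; exact: mul_continuous. Qed.

Lemma continuous_mul (T : topologicalType) (F G : T -> R) :
  continuous F -> continuous G -> continuous (fun x => F x * G x).
Proof. by move=> cF cG x; exact: (continuousM (cF x) (cG x)). Qed.

Lemma continuous_linear_rV m (f : {linear 'rV[R]_m -> R^o}) :
  continuous (f : 'rV[R]_m -> R).
Proof.
rewrite (_ : (f : _ -> _) = fun v => \sum_i v 0 i * f (delta_mx 0 i)); last first.
  apply/funext => v; rewrite [in LHS](row_sum_delta v) linear_sum.
  by apply: eq_bigr => i _; rewrite linearZ.
apply: continuous_sum => i; apply: continuous_mul; first exact: coord_continuous.
exact: cst_continuous.
Qed.

(** Adjoint matrices are linear in the coordinates of the bracket, so this determinant is a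
    polynomial in them. *)
Lemma continuous_det_killing_gram :
  continuous (fun u : 'rV[R]_N => \det (killing_gram (vecof b u))).
Proof.
have cont x j k : continuous (fun u : 'rV[R]_N => ad_mx (vecof b u) x j k).
  pose f (u : 'rV[R]_N) : R^o := ad_mx (vecof b u) x j k.
  have f_linear : linear f.
    by move=> a u v; rewrite /f /ad_mx linearP add_lfunE scale_lfunE linearP !mxE.
  pose lin := GRing.isLinear.Build R 'rV[R]_N R^o _ f f_linear.
  pose F : {linear 'rV[R]_N -> R^o} := HB.pack f lin.
  exact: (continuous_linear_rV (f := F)).
have contG i j : continuous (fun u : 'rV[R]_N => killing_gram (vecof b u) i j).
  rewrite (_ : (fun _ => _) = fun u => \sum_k \sum_l
     ad_mx (vecof b u) e`_i k l * ad_mx (vecof b u) e`_j l k); last first.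
    apply/funext => u; rewrite mxE /killing /mxtrace.
    by apply: eq_bigr => k _; rewrite mxE.
  by do 2!apply: continuous_sum => ?; apply: continuous_mul; apply: cont.
rewrite /determinant; apply: continuous_sum => s; apply: continuous_mul.
  exact: cst_continuous.
by apply: continuous_prod => i; exact: contG.
Qed.

End Topology.

Theorem corollary2p3 (R : realType) (V : vectType R) (mu : 'Hom(V, 'End(V))) :
  lie_bracket mu -> semisimple mu ->
  forall (p q : nat), (p + q)%N = \dim {:V} -> (3 <= p + q)%N ->
  forall g : {symmetric V}, nondegenerate g -> has_signature p q g ->
  ~ null_cone g mu.
Proof.
move=> lie ss p q dimV pq3 g gnd _ [_ _ cl].
apply/negP: (det_killing_gram_neq0 lie ss); apply/negPn/eqP.
have <- : \det (killing_gram (0 : bilin V)) = \det (killing_gram mu).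
  apply: (closure_usual_topology_const (f := fun nu => \det (killing_gram nu)) _ _ cl).
    exact: continuous_det_killing_gram.
  by move=> nu; apply: det_killing_gram_orbit gnd.
have -> : killing_gram (0 : bilin V) = 0.
  apply/matrixP => i j; rewrite !mxE /killing /ad_mx lfunE /= linear0 mul0mx.
  exact: mxtrace0.
(* Positive dimension matters: the empty determinant is 1. *)
have : (0 < \dim {:V})%N by rewrite -dimV (leq_trans _ pq3).
by case: (\dim {:V}) => // m _; exact: det0.
Qed.
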